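(* For every $n\ge1$ and every permutation $\pi\in\mathfrak S_n$, $\varphi(\pi)=\varepsilon(h(w(\pi)))$, where $w(\pi)=\pi_n\cdots\pi_1$ is the reversal of $\pi$.
   Context: $\mathfrak S_n$ is the symmetric group on $[n]$ in one-line notation; $\mathfrak S_0=\{\emptyset\}$. For $n\ge1$, $Y_n$ is the set of planar binary trees with $n$ internal nodes ($n+1$ leaves ordered left to right); $Y_0=\{\ast\}$, the trivial one-vertex tree. $T_1\vee T_2$ is the tree with a new root with left subtree $T_1$ and right subtree $T_2$. $\mathrm{std}(a)$ is the standardization of a word $a$ of distinct integers ($\mathrm{std}(\emptyset)=\emptyset$). $a^{<x}$ (resp. $a^{>x}$) is the subsequence of entries of $a$ strictly less (resp. greater) than $x$, in the original order. Define $\varphi:\mathfrak S_n\to Y_n$ by $\varphi(\emptyset)=\ast$ and, for $n>0$, $\varphi(\pi)=\varphi(\mathrm{std}(\pi^{<\pi_n}))\vee\varphi(\mathrm{std}(\pi^{>\pi_n}))$. Indexed terms: $\mathcal L^I$ is generated by symbols $\mathbf 2^k$ ($k$ a positive integer) of arity $2$, and for terms $\mathbf A,\mathbf B$ and $1\le m\le|\mathbf A|$ the term $\mathbf A\circ_m\mathbf B$ of arity $|\mathbf A|+|\mathbf B|-1$; no index occurs twice in a term. The evaluation $\varepsilon$ forgets indices, sends $\mathbf 2^k$ to the 2-corolla and $\mathbf A\circ_m\mathbf B$ to the tree obtained by grafting the root of $\varepsilon(\mathbf B)$ onto the $m$-th leaf of $\varepsilon(\mathbf A)$. Head-insertion encoding: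 for a word $a=a_1\cdots a_n$ of distinct positive integers, $h(a_1)=\mathbf 2^{a_1}$ and $h(a)=h(a_1\cdots a_{n-1})\circ_r\mathbf 2^{a_n}$ with $r=1+|\{j<n:a_j<a_n\}|$ for $n>1$. *)

(* Defs.v *)
From HB Require Import structures.
From mathcomp Require Import all_boot all_fingroup.

Set Implicit Arguments.
Unset Strict Implicit.
Unset Printing Implicit Defensive.

(* [Leaf] is the trivial tree, [Node l r] is the tree l \/ r; the set Y_n
   consists of the trees [t] with [nodes t = n]. *)
Inductive bintree := Leaf | Node of bintree & bintree.

Fixpoint nodes (t : bintree) : nat :=
  if t is Node l r then (nodes l + nodes r).+1 else 0.

Fixpoint leaves (t : bintree) : nat :=
  if t is Node l r then leaves l + leaves r else 1.

(* [graft t m u] grafts the root of [u] onto the [m]-th leaf of [t], leaves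
   being numbered from 1, left to right; it is [t] if there is no such leaf. *)
Fixpoint graft (t : bintree) (m : nat) (u : bintree) : bintree :=
  match t with
  | Leaf => if m == 1 then u else Leaf
  | Node l r =>
      if m <= leaves l then Node (graft l m u) r
      else Node l (graft r (m - leaves l) u)
  end.

(* One-line notation: since 'I_n is {0, ..., n-1}, values are shifted by 1. *)
Definition one_line (n : nat) (p : 'S_n) : seq nat :=
  [seq (p i).+1 | i <- enum 'I_n].

(* For a word of distinct letters, the k-th smallest letter is replaced
   by k. *)
Definition std (a : seq nat) : seq nat :=
  [seq (count (fun y => y < x) a).+1 | x <- a].

(* The first argument only bounds the recursion depth; the defining equations
   of phi are [phi_nil] and [phi_last] below. *)
Fixpoint phi_rec (k : nat) (a : seq nat) : bintree :=
  match k, a with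
  | k'.+1, a0 :: a' =>
      let x := last a0 a' in
      Node (phi_rec k' (std [seq y <- a | y < x]))
           (phi_rec k' (std [seq y <- a | x < y]))
  | _, _ => Leaf
  end.

Definition phi (a : seq nat) : bintree := phi_rec (size a) a.

Lemma size_std a : size (std a) = size a.
Proof. exact: size_map. Qed.

Lemma size_filter_lt_last (P : pred nat) a0 a :
  ~~ P (last a0 a) -> size (filter P (a0 :: a)) <= size a.
Proof.
move=> nP; rewrite size_filter -ltnS -[(size a).+1]/(size (a0 :: a)).
rewrite ltn_neqAle count_size andbT -all_count.
by apply: contra nP => /allP; apply; apply: mem_last.
Qed.

Lemma phi_rec_bound k1 k2 a :
  size a <= k1 -> size a <= k2 -> phi_rec k1 a = phi_rec k2 a.
Proof.
elim: k1 k2 a => [|k1 IHk] [|k2] [|a0 a] //=; rewrite !ltnS => le1 le2.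
by congr Node; apply: IHk; rewrite size_std;
  apply: leq_trans (size_filter_lt_last (P := fun y => _) _) _;
  rewrite // ltnn.
Qed.

Lemma phi_nil : phi [::] = Leaf.
Proof. by []. Qed.

Lemma phi_last a x : let b := rcons a x in
  phi b = Node (phi (std [seq y <- b | y < x])) (phi (std [seq y <- b | x < y])).
Proof.
case: a => [|a0 a] /=; rewrite /phi /=; first by rewrite ltnn.
rewrite last_rcons; congr Node; apply: phi_rec_bound; rewrite ?size_std //;
  by apply: (size_filter_lt_last (P := fun y => _)); rewrite last_rcons ltnn.
Qed.

Inductive rawterm :=
  | Two of nat
  | Comp of rawterm & nat & rawterm.

Fixpoint arity (t : rawterm) : nat :=
  match t with
  | Two _ => 2
  | Comp A _ B => (arity A + arity B).-1
  end.

Fixpoint indices (t : rawterm) : seq nat :=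
  match t with
  | Two k => [:: k]
  | Comp A _ B => indices A ++ indices B
  end.

Fixpoint wf_term (t : rawterm) : bool :=
  match t with
  | Two k => 0 < k
  | Comp A m B => [&& wf_term A, wf_term B & 1 <= m <= arity A]
  end.

(* The set L^I of indexed terms. *)
Record iterm := ITerm {
  iterm_val :> rawterm;
  iterm_wf : wf_term iterm_val;
  iterm_uniq : uniq (indices iterm_val)
}.

Fixpoint eval_raw (t : rawterm) : bintree :=
  match t with
  | Two _ => Node Leaf Leaf
  | Comp A m B => graft (eval_raw A) m (eval_raw B)
  end.

Definition eval (t : iterm) : bintree := eval_raw t.

Record word := Word {
  word_val :> seq nat;
  word_nonempty : 0 < size word_val;
  word_pos : all (fun x => 0 < x) word_val;
  word_uniq : uniq word_val
}.

(* [h_rev b] is the encoding of the reversal of [b], so that the recursion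
   removes the last letter of the encoded word; the value at the empty word is
   irrelevant. *)
Fixpoint h_rev (b : seq nat) : rawterm :=
  match b with
  | [::] => Two 0
  | [:: x] => Two x
  | x :: b' => Comp (h_rev b') (1 + count (fun y => y < x) b') (Two x)
  end.

Definition h_raw (a : seq nat) : rawterm := h_rev (rev a).

Lemma h_raw1 x : h_raw [:: x] = Two x.
Proof. by []. Qed.

Lemma h_raw_rcons a x : 0 < size a ->
  h_raw (rcons a x) = Comp (h_raw a) (1 + count (fun y => y < x) a) (Two x).
Proof.
rewrite /h_raw rev_rcons -(count_rev _ a) -(size_rev a).
by case: (rev a).
Qed.

Lemma arity_h_raw a : 0 < size a -> arity (h_raw a) = (size a).+1.
Proof.
elim/last_ind: a => // a x IHa _; case: (posnP (size a)) => [/size0nil -> //|a0].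
by rewrite h_raw_rcons //= IHa // size_rcons addn2.
Qed.

Lemma indices_h_raw a : 0 < size a -> indices (h_raw a) = a.
Proof.
elim/last_ind: a => // a x IHa _; case: (posnP (size a)) => [/size0nil -> //|a0].
by rewrite h_raw_rcons //= IHa // cats1.
Qed.

Lemma wf_h_raw a :
  0 < size a -> all (fun x => 0 < x) a -> wf_term (h_raw a).
Proof.
elim/last_ind: a => // a x IHa _; rewrite all_rcons => /andP[x0 a_pos].
case: (posnP (size a)) => [/size0nil ->|a0]; first by rewrite h_raw1.
by rewrite h_raw_rcons //= IHa // x0 arity_h_raw // ltnS count_size.
Qed.

Lemma uniq_h_raw (a : word) : uniq (indices (h_raw a)).
Proof. by rewrite indices_h_raw ?word_uniq ?word_nonempty. Qed.

Definition h (a : word) : iterm :=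
  ITerm (wf_h_raw (word_nonempty a) (word_pos a)) (uniq_h_raw a).

Lemma size_rev_one_line n (p : 'S_n) : 1 <= n -> 0 < size (rev (one_line p)).
Proof. by rewrite size_rev size_map size_enum_ord. Qed.

Lemma pos_rev_one_line n (p : 'S_n) : all (fun x => 0 < x) (rev (one_line p)).
Proof. by rewrite all_rev all_map; apply/allP. Qed.

Lemma uniq_rev_one_line n (p : 'S_n) : uniq (rev (one_line p)).
Proof.
by rewrite rev_uniq map_inj_uniq ?enum_uniq // => i j [] /val_inj /perm_inj.
Qed.

Definition w (n : nat) (n_gt0 : 1 <= n) (p : 'S_n) : word :=
  Word (size_rev_one_line p n_gt0) (pos_rev_one_line p) (uniq_rev_one_line p).

Lemma nodes_phi a : uniq a -> nodes (phi a) = size a.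
Proof.
elim: {a}(size a) {-2}a (leqnn (size a)) => [[]//|k IHk] a.
case/lastP: a => [//|a x]; rewrite size_rcons ltnS phi_last /= => lak.
rewrite rcons_uniq => /andP[xa Ua].
have E (P : pred nat) : ~~ P x -> filter P (rcons a x) = filter P a.
  by rewrite filter_rcons => /negPf->.
have Ustd b : uniq b -> uniq (std b).
  move=> Ub; rewrite map_inj_in_uniq // => i j bi bj [].
  have lt u v : u \in b -> u < v ->
      count (fun y => y < u) b < count (fun y => y < v) b.
    move=> bu uv; rewrite -!size_filter.
    rewrite -[_.+1]/(size (u :: [seq y <- b | y < u])).
    apply: uniq_leq_size; first by rewrite /= mem_filter ltnn filter_uniq.
    move=> z; rewrite inE !mem_filter => /predU1P[->|/andP[zu ->]].
      by rewrite uv.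
    by rewrite (ltn_trans zu).
  by case: (ltngtP i j) => // /lt H; [have := H bi | have := H bj] => + eq;
     rewrite eq ltnn.
rewrite !E ?ltnn // !IHk ?Ustd ?filter_uniq // ?size_std;
  try by rewrite size_filter (leq_trans (count_size _ _)).
rewrite !size_filter; congr _.+1.
rewrite -[RHS](count_predC (fun y => y < x)); congr (_ + _).
apply: eq_in_count => y ya /=; rewrite -leqNgt ltn_neqAle andbC.
by case: eqP ya xa => [->->//|_ _ _]; rewrite andbT.
Qed.

(* Main.v *)
Require Import Defs.
From mathcomp Require Import all_boot all_fingroup.

(** Reading [pi] from right to left, the encoding performs insertion into a
    binary search tree: the first inserted letter is the root, and grafting a
    corolla at leaf [1 + #{smaller letters}] acts only on the left or only on the
    right subtree, according to how the letter compares with the root. Hence the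
    tree satisfies the recursion defining [phi]; the standardizations there are
    harmless since insertion depends only on the relative order of the letters. *)

(** The last letter of [b] is inserted first, as in [h_rev]; starting from [Leaf] makes the
    one-letter word no special case. *)
Fixpoint insertion_tree (b : seq nat) : bintree :=
  if b is x :: b' then
    graft (insertion_tree b') (count (fun y => y < x) b').+1 (Node Leaf Leaf)
  else Leaf.

Lemma eval_raw_h_rev b : 0 < size b -> eval_raw (h_rev b) = insertion_tree b.
Proof. by elim: b => // x [|y b] IHb _ //; rewrite [LHS]/= IHb. Qed.

Lemma leaves_graft t m u : 0 < m <= leaves t ->
  leaves (graft t m u) = (leaves t + leaves u).-1.
Proof.
elim: t m => [|l IHl r IHr] m /=; first by case: m => [|[|m]].
case/andP=> m_gt0 le_m; have leaves_gt0 t : 0 < leaves t.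
  by elim: t => //= t1 H1 t2 H2; rewrite addn_gt0 H1.
case: leqP => lm /=.
  rewrite IHl ?m_gt0 // -(prednK (leaves_gt0 l)) !addSn /=.
  by rewrite addnAC.
rewrite IHr ?subn_gt0 ?lm ?leq_subLR //.
by rewrite -(prednK (leaves_gt0 r)) !addnS !addSn /= addnA.
Qed.

(** Used to decide which subtree of the root [graft] enters. *)
Lemma leaves_insertion_tree b : leaves (insertion_tree b) = (size b).+1.
Proof.
elim: b => //= x b IHb.
by rewrite leaves_graft IHb /= ?ltnS ?count_size // addn2.
Qed.

Lemma insertion_tree_rcons b x : uniq (rcons b x) ->
  insertion_tree (rcons b x) =
  Node (insertion_tree [seq y <- b | y < x])
       (insertion_tree [seq y <- b | x < y]).
Proof.
elim: b => //= y b IHb /andP[]; rewrite mem_rcons inE negb_or => /andP[yx yb] Ub.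
rewrite IHb //= leaves_insertion_tree -cats1 count_cat /= addn0 ltnS.
have xb : x \notin b by move: Ub; rewrite rcons_uniq => /andP[].
case: (ltngtP y x) yx => //= [yx _|xy _].
  (* Every letter below [y] is below [x], so the position is the one in the left subtree. *)
  have eq_count : count (fun z => z < y) b =
                  count (fun z => z < y) [seq z <- b | z < x].
    rewrite count_filter; apply: eq_count => z /=.
    by apply/idP/andP=> [zy|[]//]; split=> //; exact: (ltn_trans zy yx).
  by rewrite addn0 eq_count count_size.
(* As [x] does not occur in [b], the letters below [y] are those below [x] and those strictly
   between. *)
have -> : count (fun z => z < y) b =
    size [seq z <- b | z < x] + count (fun z => z < y) [seq z <- b | x < z].
  rewrite size_filter count_filter -count_predUI.
  rewrite [X in _ + X](_ : _ = 0) ?addn0.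
    apply: eq_in_count => z zb /=; case: (ltngtP z x) => [zx|zx|eq_zx] /=.
    - by rewrite (ltn_trans zx xy).
    - by rewrite andbT.
    - by rewrite -eq_zx zb in xb.
  apply/eqP; rewrite -leqn0 leqNgt -has_count; apply/hasPn=> z _ /=.
  by case: (ltngtP z x); rewrite ?andbF.
(* The root [x] also counts as smaller than [y]; this extra one matches the extra leaf of the left
   subtree when its leaves are subtracted. *)
rewrite addn1 ltnNge leq_addr /=; congr (Node _ (graft _ _ _)).
by rewrite -addnS subSS addKn.
Qed.

Lemma insertion_tree_map (f : nat -> nat) b :
  {in b &, {mono f : x y / x < y}} ->
  insertion_tree (map f b) = insertion_tree b.
Proof.
elim: b => //= x b IHb mono_f; rewrite IHb; last first.
  by move=> y z yb zb; apply: mono_f; rewrite inE ?yb ?zb orbT.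
rewrite count_map; congr (graft _ _.+1 _); apply: eq_in_count => y yb /=.
by rewrite mono_f ?mem_head // inE yb orbT.
Qed.

Lemma std_mono b :
  {in b &, {mono (fun x => (count (fun y => y < x) b).+1) : x y / x < y}}.
Proof.
have le_count x y : x <= y -> count (fun z => z < x) b <= count (fun z => z < y) b.
  by move=> le_xy; apply: sub_count => z /= /leq_trans; apply.
move=> x y xb _ /=; rewrite ltnS; case: (leqP y x) => [/le_count|lt_xy].
  by rewrite leqNgt => /negPf.
(* Passing from the bound [x] to [x.+1] adds the occurrences of [x], at least one since [x] lies in
   [b]. *)
apply: (leq_trans _ (le_count x.+1 y lt_xy)).
have -> : count (fun z => z < x.+1) b =
          count (fun z => z < x) b + count (pred1 x) b.
  rewrite -count_predUI [X in _ = _ + X](_ : _ = 0) ?addn0.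
    by apply: eq_count => z /=; rewrite ltnS leq_eqVlt orbC.
  apply/eqP; rewrite -leqn0 leqNgt -has_count; apply/hasPn=> z _ /=.
  by case: ltngtP.
by rewrite -addn1 leq_add2l -has_count has_pred1.
Qed.

Lemma std_uniq b : uniq b -> uniq (std b).
Proof.
move=> Ub; rewrite map_inj_in_uniq // => x y xb yb eq_xy.
have := std_mono _ _ _ xb yb; have := std_mono _ _ _ yb xb.
by rewrite /= eq_xy ltnn; case: ltngtP.
Qed.

Lemma phi_insertion_tree a : uniq a -> phi a = insertion_tree a.
Proof.
(* Induction on length, since the recursive calls of [phi] are on standardized words, not
   subwords. *)
have [k] := ubnP (size a); elim: k a => // k IHk a.
case/lastP: a => [//|a x]; rewrite size_rcons ltnS => lt_ak Ua.
have phi_std (P : pred nat) : ~~ P x ->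
    phi (std [seq y <- rcons a x | P y]) = insertion_tree [seq y <- a | P y].
  move=> nPx; rewrite filter_rcons (negPf nPx) IHk.
  - by rewrite insertion_tree_map //; apply: std_mono.
  - by rewrite size_std size_filter (leq_ltn_trans (count_size _ _)).
  - by rewrite std_uniq // filter_uniq //; move: Ua; rewrite rcons_uniq => /andP[].
by rewrite phi_last insertion_tree_rcons // !phi_std ?ltnn.
Qed.

Theorem theorem4p10 (n : nat) (hn : 1 <= n) (pi : 'S_n) :
  phi (one_line pi) = eval (h (w hn pi)).
Proof.
rewrite phi_insertion_tree; last by rewrite -rev_uniq uniq_rev_one_line.
(* The reversal in [w] cancels the one in [h_raw]. *)
rewrite /eval /= /h_raw revK eval_raw_h_rev // -size_rev.
exact: size_rev_one_line.
Qed.
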